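(* There is an algorithm that, given a complete deterministic finite automaton $\mathcal{A} = \langle Q,\Sigma,\delta\rangle$, checks whether $\mathcal{A}$ preserves a nontrivial partial order on $Q$, and finds such a partial order if one exists, in $O(|\Sigma|\times|Q|^6)$ time and $O(|Q|^2)$ working space.
   Context: An automaton is a complete deterministic finite (semi)automaton $\mathcal{A} = \langle Q,\Sigma,\delta\rangle$, where $Q$ is a finite set of states, $\Sigma$ is a finite input alphabet, and $\delta\colon Q\times\Sigma\to Q$ is a (total) transition function; there are no initial or final states. The automaton $\mathcal{A}$ preserves a partial order $\le$ on $Q$ if $p\le q$ implies $\delta(p,a)\le\delta(q,a)$ for all $p,q\in Q$ and $a\in\Sigma$. A partial order on $Q$ is nontrivial if at least one pair of distinct states is comparable. *)

(* Defs.v *)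
From mathcomp Require Import all_boot.

Set Implicit Arguments.
Unset Strict Implicit.
Unset Printing Implicit Defensive.

Record automaton := Automaton {
  state : finType;
  letter : finType;
  trans : state -> letter -> state }.

Definition partial_order (T : Type) (r : rel T) : Prop :=
  [/\ reflexive r, antisymmetric r & transitive r].

Definition nontrivial (T : Type) (r : rel T) : Prop :=
  exists p q : T, p <> q /\ r p q.

Definition preserves (A : automaton) (r : rel (state A)) : Prop :=
  forall (p q : state A) (a : letter A),
    r p q -> r (trans p a) (trans q a).

Definition nontrivial_preserved_order (A : automaton) (r : rel (state A)) :
    Prop :=
  [/\ partial_order r, nontrivial r & preserves r].

(* Model of computation: a word RAM running structured programs.  It has a    *)
(* read-only input [inp], a random-access working memory [m] consisting of    *)
(* [size m] words, and a write-only output that is not charged as working     *)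
(* space.  A word is a natural number below [2 ^ w], where [w] is the word    *)
(* length.  Overflowing a word, or accessing the input or the memory out of   *)
(* bounds, is a fault: the program then has no halting run.                   *)

Inductive binop := Add | Sub | Mul | Lt | Eq.

Definition binop_eval (o : binop) (x y : nat) : nat :=
  match o with
  | Add => x + y
  | Sub => x - y
  | Mul => x * y
  | Lt => x < y
  | Eq => x == y
  end.

Inductive expr :=
  | Const of nat
  | Inp of expr  (* the input word at the given position *)
  | Mem of expr  (* the memory word at the given address *)
  | Bin of binop & expr & expr.

Definition word (w x : nat) : option nat := if x < 2 ^ w then Some x else None.

Fixpoint eval (w : nat) (inp m : seq nat) (e : expr) : option nat :=
  match e with
  | Const x => word w x
  | Inp e1 => obind (word w) (obind (onth inp) (eval w inp m e1))
  | Mem e1 => obind (word w) (obind (onth m) (eval w inp m e1))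
  | Bin o e1 e2 =>
      obind (fun x => obind (fun y => word w (binop_eval o x y))
                            (eval w inp m e2))
            (eval w inp m e1)
  end.

(* One time unit for each elementary operation. *)
Fixpoint cost (e : expr) : nat :=
  match e with
  | Const _ => 1
  | Inp e1 | Mem e1 => (cost e1).+1
  | Bin _ e1 e2 => (cost e1 + cost e2).+1
  end.

Inductive cmd :=
  | Skip
  | Assign of expr & expr  (* store the second value at the first address *)
  | Write of expr          (* append a word to the output *)
  | Seq of cmd & cmd
  | If of expr & cmd & cmd
  | While of expr & cmd.

(* [exec w inp c m t out m']: started with memory [m], the command [c] halts  *)
(* after [t] time units with memory [m'], having written [out].  The relation *)
(* is deterministic and no rule changes the size of the memory.               *)
Inductive exec (w : nat) (inp : seq nat) :
    cmd -> seq nat -> nat -> seq nat -> seq nat -> Prop :=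
  | exec_skip m :
      exec w inp Skip m 1 [::] m
  | exec_assign e1 e2 m a x :
      eval w inp m e1 = Some a -> eval w inp m e2 = Some x -> a < size m ->
      exec w inp (Assign e1 e2) m (cost e1 + cost e2).+1 [::] (set_nth 0 m a x)
  | exec_write e m x :
      eval w inp m e = Some x ->
      exec w inp (Write e) m (cost e).+1 [:: x] m
  | exec_seq c1 c2 m1 m2 m3 t1 t2 out1 out2 :
      exec w inp c1 m1 t1 out1 m2 -> exec w inp c2 m2 t2 out2 m3 ->
      exec w inp (Seq c1 c2) m1 (t1 + t2) (out1 ++ out2) m3
  | exec_if e c1 c2 m x t out m' :
      eval w inp m e = Some x ->
      exec w inp (if x != 0 then c1 else c2) m t out m' ->
      exec w inp (If e c1 c2) m ((cost e).+1 + t) out m'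
  | exec_while_stop e c m :
      eval w inp m e = Some 0 ->
      exec w inp (While e c) m (cost e).+1 [::] m
  | exec_while_step e c m1 m2 m3 x t1 t2 out1 out2 :
      eval w inp m1 e = Some x -> x != 0 ->
      exec w inp c m1 t1 out1 m2 -> exec w inp (While e c) m2 t2 out2 m3 ->
      exec w inp (While e c) m1 ((cost e).+1 + t1 + t2) (out1 ++ out2) m3.

(* The working memory consists of [s] words, initially zero. *)
Definition halts (w s : nat) (inp : seq nat) (c : cmd) (t : nat)
    (out : seq nat) : Prop :=
  exists m', exec w inp c (nseq s 0) t out m'.

(* States and letters are numbered from 0 along their enumerations; the       *)
(* transition table is listed state by state.                                 *)
Definition encode_automaton (A : automaton) : seq nat :=
  #|state A| :: #|letter A| ::
  [seq (enum_rank (trans q a) : nat) | q <- enum (state A),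
                                       a <- enum (letter A)].

Definition encode_rel (T : finType) (r : rel T) : seq nat :=
  [seq (r p q : nat) | p <- enum T, q <- enum T].

(* The output is a bit telling whether a nontrivial preserved order exists,   *)
(* followed, if so, by the matrix of one such order.                          *)
Definition correct_output (A : automaton) (out : seq nat) : Prop :=
  (out = [:: 0] /\
     ~ exists r : rel (state A), nontrivial_preserved_order r) \/
  (exists r : rel (state A),
     nontrivial_preserved_order r /\ out = 1 :: encode_rel r).

(* Main.v *)
Require Import Defs.
From mathcomp Require Import all_boot.
From mathcomp Require Import zify.

(** If some nontrivial preserved order has [p < q], it contains the least
    preserved preorder with [p <= q], which is then antisymmetric; so it is
    enough to test these principal preorders for antisymmetry.  The principal
    preorder is the transitive closure of the union of the identity and of the
    orbit of [(p, q)] under the letters.  For each pair, the program saturates a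
    Boolean matrix: every pair of the orbit is reached by a word of
    length at most [|Q| ^ 2], so [|Q| ^ 2] rounds of cost [|Sigma| * |Q| ^ 2]
    give the orbit, and [|Q|] rounds of cost [|Q| ^ 3] give its transitive
    closure. *)

Set Implicit Arguments.
Unset Strict Implicit.
Unset Printing Implicit Defensive.

(** * Row-major lists and encoded relations *)

Lemma onth_nth (T : Type) (x0 : T) (s : seq T) i :
  i < size s -> onth s i = Some (nth x0 s i).
Proof. by elim: s i => [|x s IHs] [|i] //= /IHs. Qed.

Lemma onth_size (T : Type) (s : seq T) i x : onth s i = Some x -> i < size s.
Proof. by elim: s i => [|y s IHs] [|i] //= /IHs. Qed.

Lemma nth_allpairs (S T R : Type) (f : S -> T -> R) s t x0 y0 z0 i j :
  i < size s -> j < size t ->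
  nth z0 (allpairs f s t) (i * size t + j) = f (nth x0 s i) (nth y0 t j).
Proof.
elim: s i => [|x s IHs] [|i] //= lt_i lt_j; rewrite nth_cat size_map.
  by rewrite lt_j (nth_map y0).
by rewrite mulSn -addnA ltnNge leq_addr /= addKn IHs.
Qed.

Lemma nth_allpairs_enum (S T : finType) (R : Type) (f : S -> T -> R) z0 x y :
  nth z0 [seq f u v | u <- enum S, v <- enum T]
      (enum_rank x * #|T| + enum_rank y) = f x y.
Proof.
rewrite [X in _ * X]cardE (nth_allpairs _ x y) -?cardE //.
by rewrite !nth_enum_rank.
Qed.

Lemma enum_rank_ltS (T : finType) (x y : T) :
  (enum_rank x < (enum_rank y).+1) = (x == y) || (enum_rank x < enum_rank y).
Proof. by rewrite ltnS leq_eqVlt val_eqE (inj_eq enum_rank_inj). Qed.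

Lemma mixed_radix_lt m n i j : i < m -> j < n -> i * n + j < m * n.
Proof. nia. Qed.

Lemma rank_pair_lt (S T : finType) (x : S) (y : T) :
  enum_rank x * #|T| + enum_rank y < #|S| * #|T|.
Proof. exact: mixed_radix_lt. Qed.

Lemma size_encode_rel (T : finType) (r : rel T) :
  size (encode_rel r) = #|T| * #|T|.
Proof. by rewrite size_allpairs -cardE. Qed.

Lemma eq_encode_rel (T : finType) (r r' : rel T) :
  r =2 r' -> encode_rel r = encode_rel r'.
Proof.
move=> eq_r; rewrite /encode_rel; congr flatten.
by apply: eq_map => x; apply: eq_map => y; rewrite eq_r.
Qed.

Definition upd (T : eqType) (r : rel T) (x y : T) (b : bool) : rel T :=
  fun u v => if (u == x) && (v == y) then b else r u v.

(** Division with remainder by [#|T|] writes every valid index as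
    [enum_rank u * #|T| + enum_rank v]. Quotient and remainder recover [u] and [v], so distinct
    pairs occupy distinct positions. *)
Lemma set_nth_encode_rel (T : finType) (r : rel T) x y (b : bool) :
  set_nth 0 (encode_rel r) (enum_rank x * #|T| + enum_rank y) b =
  encode_rel (upd r x y b).
Proof.
have lt_xy := rank_pair_lt x y.
apply: (@eq_from_nth _ 0) => [|i].
  by rewrite size_set_nth !size_encode_rel; apply/maxn_idPr.
rewrite size_set_nth size_encode_rel (maxn_idPr lt_xy) => lt_i.
have T_gt0 : 0 < #|T| by nia.
have lt_d : i %/ #|T| < #|T| by rewrite ltn_divLR.
have lt_m : i %% #|T| < #|T| by rewrite ltn_mod.
pose u := enum_val (Ordinal lt_d); pose v := enum_val (Ordinal lt_m).
have -> : i = enum_rank u * #|T| + enum_rank v.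
  by rewrite !enum_valK /= -divn_eq.
rewrite nth_set_nth /= /encode_rel !nth_allpairs_enum /upd.
case: ifP => [/eqP eq_i | ne_i]; last first.
  by case: ifP => // /andP[/eqP eq_u /eqP eq_v]; rewrite eq_u eq_v eqxx in ne_i.
suff /andP[/eqP -> /eqP ->] : (u == x) && (v == y) by rewrite !eqxx.
have := congr1 (modn^~ #|T|) eq_i; have := congr1 (divn^~ #|T|) eq_i.
rewrite !divnMDl ?modnMDl // !modn_small // !divn_small // !addn0.
by move=> /val_inj/enum_rank_inj -> /val_inj/enum_rank_inj ->; rewrite !eqxx.
Qed.

(** * Principal preserved preorders *)

Section PrincipalOrder.

Variables (A : automaton) (p q : state A).

(** One letter acting on both components at once; [connect pair_step (p, q)] is the orbit of the
    pair under all words. *)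
Definition pair_step : rel (state A * state A) :=
  fun u v => [exists a, v == (trans u.1 a, trans u.2 a)].

Definition orbit_rel : rel (state A) :=
  fun x y => (x == y) || connect pair_step (p, q) (x, y).

Definition principal_preorder : rel (state A) := connect orbit_rel.

Lemma orbit_rel_trans x y a :
  orbit_rel x y -> orbit_rel (trans x a) (trans y a).
Proof.
case/orP=> [/eqP-> | pq_xy]; first by rewrite /orbit_rel eqxx.
apply/orP; right; apply: connect_trans pq_xy (connect1 _).
by apply/existsP; exists a.
Qed.

(** A letter maps each edge of [orbit_rel] to an edge, hence each path to a path. *)
Lemma preserves_principal_preorder : preserves principal_preorder.
Proof.
move=> x y a /connectP[s]; elim: s x => [|z s IHs] x /=.
  by move=> _ ->; apply: connect0.
case/andP=> xz zs /IHs; move=> /(_ zs); apply: connect_trans.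
exact: connect1 (orbit_rel_trans a xz).
Qed.

Lemma principal_preorder_pq : principal_preorder p q.
Proof. by apply: connect1; rewrite /orbit_rel connect0 orbT. Qed.

(** Preservation carries [r p q] along the orbit, and transitivity then carries [r] along chains of
    orbit pairs. Antisymmetry of [r] is thereby inherited by the principal preorder. *)
Lemma principal_preorder_min (r : rel (state A)) :
  partial_order r -> preserves r -> r p q -> subrel principal_preorder r.
Proof.
case=> r_refl _ r_trans r_pres r_pq.
have r_connect u v : connect pair_step u v -> r u.1 u.2 -> r v.1 v.2.
  case/connectP=> s; elim: s u => [|z s IHs] u /=; first by move=> _ ->.
  by case/andP=> /existsP[a /eqP->] zs eq_v ru;
  apply: IHs zs eq_v (r_pres _ _ _ ru).
have sub_r x y : orbit_rel x y -> r x y.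
  by case/orP=> [/eqP-> //|/r_connect]; apply.
move=> x y /connectP[s]; elim: s x => [|z s IHs] x /=; first by move=> _ ->.
by case/andP=> /sub_r xz zs eq_y; apply: r_trans xz (IHs _ zs eq_y).
Qed.

Lemma principal_order :
  p != q -> antisymmetric principal_preorder ->
  nontrivial_preserved_order principal_preorder.
Proof.
move=> ne_pq anti; split; last exact: preserves_principal_preorder.
- by split=> //; [apply: connect0 | apply: connect_trans].
- by exists p, q; split; [apply/eqP | apply: principal_preorder_pq].
Qed.

End PrincipalOrder.

(** * Weakest preconditions with time bounds *)

Definition var i := Defs.Mem (Const i).
Definition nstates := Inp (Const 0).
Definition nletters := Inp (Const 1).

Definition For i bound body :=
  Seq (Assign (Const i) (Const 0))
      (While (Bin Lt (var i) bound)
             (Seq body (Assign (Const i) (Bin Add (var i) (Const 1))))).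

Section Logic.

Variables (w : nat) (inp : seq nat).

Lemma eval_const m x : x < 2 ^ w -> eval w inp m (Const x) = Some x.
Proof. by rewrite /= /word => ->. Qed.

Lemma eval_mem m e a x :
    eval w inp m e = Some a -> onth m a = Some x -> x < 2 ^ w ->
  eval w inp m (Defs.Mem e) = Some x.
Proof. by rewrite /= => -> /= -> /=; rewrite /word => ->. Qed.

Lemma eval_inp m e a x :
    eval w inp m e = Some a -> onth inp a = Some x -> x < 2 ^ w ->
  eval w inp m (Inp e) = Some x.
Proof. by rewrite /= => -> /= -> /=; rewrite /word => ->. Qed.

Lemma eval_bin m op e1 e2 x1 x2 :
    eval w inp m e1 = Some x1 -> eval w inp m e2 = Some x2 ->
    binop_eval op x1 x2 < 2 ^ w ->
  eval w inp m (Bin op e1 e2) = Some (binop_eval op x1 x2).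
Proof. by rewrite /= => -> /= -> /=; rewrite /word => ->. Qed.

Lemma eval_add m e1 e2 x1 x2 :
    eval w inp m e1 = Some x1 -> eval w inp m e2 = Some x2 ->
    x1 + x2 < 2 ^ w ->
  eval w inp m (Bin Add e1 e2) = Some (x1 + x2).
Proof. exact: (@eval_bin _ Add). Qed.

Lemma eval_mul m e1 e2 x1 x2 :
    eval w inp m e1 = Some x1 -> eval w inp m e2 = Some x2 ->
    x1 * x2 < 2 ^ w ->
  eval w inp m (Bin Mul e1 e2) = Some (x1 * x2).
Proof. exact: (@eval_bin _ Mul). Qed.

(* Assertions see the output accumulated since the start of the program. *)
Definition wp c t (Q : seq nat -> seq nat -> Prop) o m :=
  exists t' o' m', [/\ exec w inp c m t' o' m', t' <= t & Q (o ++ o') m'].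

Lemma wp_conseq c t t' (Q Q' : seq nat -> seq nat -> Prop) o m :
  wp c t Q o m -> t <= t' -> (forall o m, Q o m -> Q' o m) -> wp c t' Q' o m.
Proof.
case=> u [o' [m' [ex le_u Qm]]] le_t QQ'.
by exists u, o', m'; split; [|apply: leq_trans le_t|apply: QQ'].
Qed.

Lemma wp_leq c t t' Q o m : wp c t Q o m -> t <= t' -> wp c t' Q o m.
Proof. by move=> wpQ le_t; apply: wp_conseq wpQ le_t _. Qed.

Lemma wp_skip Q o m : Q o m -> wp Skip 1 Q o m.
Proof. by exists 1, [::], m; rewrite cats0; split=> //; constructor. Qed.

Lemma wp_seq c1 c2 t1 t2 Q o m :
  wp c1 t1 (wp c2 t2 Q) o m -> wp (Seq c1 c2) (t1 + t2) Q o m.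
Proof.
case=> u1 [o1 [m1 [ex1 le1 [u2 [o2 [m2 [ex2 le2 Qm]]]]]]].
exists (u1 + u2), (o1 ++ o2), m2; rewrite catA leq_add //.
by split=> //; apply: exec_seq ex1 ex2.
Qed.

Lemma wp_assign e1 e2 a x (Q : seq nat -> seq nat -> Prop) o m :
    eval w inp m e1 = Some a -> eval w inp m e2 = Some x -> a < size m ->
    Q o (set_nth 0 m a x) ->
  wp (Assign e1 e2) (cost e1 + cost e2).+1 Q o m.
Proof.
move=> ev1 ev2 lt_a Qm; exists (cost e1 + cost e2).+1, [::], (set_nth 0 m a x).
by rewrite cats0; split=> //; apply: exec_assign.
Qed.

Lemma wp_write e x (Q : seq nat -> seq nat -> Prop) o m :
  eval w inp m e = Some x -> Q (rcons o x) m -> wp (Write e) (cost e).+1 Q o m.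
Proof.
move=> ev Qm; exists (cost e).+1, [:: x], m; rewrite cats1.
by split=> //; apply: exec_write.
Qed.

Lemma wp_if e c1 c2 x t Q o m :
    eval w inp m e = Some x -> wp (if x != 0 then c1 else c2) t Q o m ->
  wp (If e c1 c2) ((cost e).+1 + t) Q o m.
Proof.
move=> ev [u [o' [m' [ex le_u Qm]]]]; exists ((cost e).+1 + u), o', m'.
by rewrite leq_add2l; split=> //; apply: exec_if ev ex.
Qed.

(** The invariant pins the counter cell to [j], and the body must hand it back unchanged for the
    increment. The constant 20 generously covers test and increment; the extra round in [N.+1] pays
    for the initialisation and the last, failing test. *)
Lemma wp_for N e i c t (J : nat -> seq nat -> seq nat -> Prop) o m :
    (forall m, eval w inp m e = Some N) -> N < 2 ^ w -> i < 2 ^ w ->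
    i < size m ->
    (forall j o m, J j o m -> onth m i = Some j) ->
    J 0 o (set_nth 0 m i 0) ->
    (forall j o m, j < N -> J j o m ->
       wp c t (fun o m => onth m i = Some j /\ J j.+1 o (set_nth 0 m i j.+1))
          o m) ->
  wp (For i e c) (N.+1 * (t + cost e + 20)) (J N) o m.
Proof.
move=> evN ltN lt_i sz_m JE J0 Jstep.
(* Induction on the number [k] of rounds still to run. *)
have loop k j o1 m1 : k + j = N -> J j o1 m1 ->
    wp (While (Bin Lt (var i) e)
              (Seq c (Assign (Const i) (Bin Add (var i) (Const 1)))))
       (k * (t + cost e + 20) + (cost e + 5)) (J N) o1 m1.
  elim: k j o1 m1 => [|k IHk] j o1 m1 eqN Jj.
    rewrite add0n in eqN; subst j.
    exists (cost (Bin Lt (var i) e)).+1, [::], m1; rewrite cats0; split=> //.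
      apply: exec_while_stop.
      rewrite (@eval_bin _ Lt _ _ N N) //= ?ltnn ?expn_gt0 //.
      exact: (eval_mem (eval_const _ lt_i) (JE _ _ _ Jj)).
    rewrite /=; lia.
  have lt_jN : j < N by lia.
  have [t1 [o2 [m2 [ex1 le1 [onth2 J2]]]]] := Jstep _ _ _ lt_jN Jj.
  have eqN' : k + j.+1 = N by lia.
  have [t2 [o3 [m3 [ex2 le2 J3]]]] := IHk _ _ _ eqN' J2.
  have lt1 : 1 < 2 ^ w by lia.
  exists ((cost (Bin Lt (var i) e)).+1 + (t1 + 6) + t2), (o2 ++ o3), m3.
  split; [|rewrite /=; nia|by rewrite catA].
  rewrite -[o2]cats0.
  apply: exec_while_step (_ : _ = Some 1) _ (exec_seq ex1 _) ex2 => //.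
    rewrite (@eval_bin _ Lt _ _ j N) /= ?lt_jN //.
    by apply: (eval_mem (eval_const _ lt_i) (JE _ _ _ Jj)); lia.
  rewrite (_ : 6 = (cost (Const i) + cost (Bin Add (var i) (Const 1))).+1) //.
  apply: exec_assign; first exact: eval_const.
    rewrite (@eval_bin _ Add _ _ j 1) /= ?addn1 //; last lia.
    - by apply: (eval_mem (eval_const _ lt_i) onth2); lia.
    - exact: eval_const.
  exact: onth_size onth2.
apply: (@wp_conseq _ (3 + (N * (t + cost e + 20) + (cost e + 5))) _ (J N)) => //.
  apply: wp_seq; apply: (@wp_assign _ _ i 0) => //.
  - exact: eval_const.
  - exact/eval_const/(leq_ltn_trans _ ltN).
  - by apply: (loop N 0 _ _ _ J0); rewrite addn0.
nia.
Qed.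

End Logic.

(** * The program *)

(* Cell 0 holds the success flag, cells 1 and 2 the candidate pair, cells 3 to 6
   the loop counters; the matrix starts at cell 7. *)
Definition base := 7.

Definition cell e1 e2 :=
  Bin Add (Const base) (Bin Add (Bin Mul e1 nstates) e2).

Definition entry e1 e2 := Defs.Mem (cell e1 e2).

(** The offset 2 skips the two leading input words, which hold the numbers of states and letters. *)
Definition target e1 e2 :=
  Inp (Bin Add (Const 2) (Bin Add (Bin Mul e1 nletters) e2)).

(** Product and sum of bits act as conjunction and disjunction; the sum remains a bit because the
    candidate pair is off the diagonal. *)
Definition init_matrix :=
  For 3 nstates (For 4 nstates
    (Assign (cell (var 3) (var 4))
       (Bin Add (Bin Eq (var 3) (var 4))
          (Bin Mul (Bin Eq (var 3) (var 1)) (Bin Eq (var 4) (var 2)))))).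

(** Cell 3 only counts rounds. Updates are made in place, so a round may add more than one
    synchronous step would. *)
Definition close_letters :=
  For 3 (Bin Mul nstates nstates) (For 4 nstates (For 5 nstates (For 6 nletters
    (If (entry (var 4) (var 5))
        (Assign (cell (target (var 4) (var 6)) (target (var 5) (var 6)))
                (Const 1))
        Skip)))).

Definition close_trans :=
  For 3 nstates (For 4 nstates (For 5 nstates (For 6 nstates
    (If (Bin Mul (entry (var 4) (var 5)) (entry (var 5) (var 6)))
        (Assign (cell (var 4) (var 6)) (Const 1))
        Skip)))).

Definition check_antisym :=
  Seq (Assign (Const 0) (Const 1))
    (For 3 nstates (For 4 nstates
      (If (Bin Mul (Bin Mul (entry (var 3) (var 4)) (entry (var 4) (var 3)))
                   (Bin Eq (Bin Eq (var 3) (var 4)) (Const 0)))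
          (Assign (Const 0) (Const 0))
          Skip))).

(** The guard skips diagonal pairs and, once the flag is set, all remaining pairs, so the successful
    matrix survives until it is reported. *)
Definition search :=
  For 1 nstates (For 2 nstates
    (If (Bin Add (var 0) (Bin Eq (var 1) (var 2)))
        Skip
        (Seq init_matrix
          (Seq close_letters (Seq close_trans check_antisym))))).

Definition report :=
  If (var 0)
     (Seq (Write (Const 1))
        (For 1 (Bin Mul nstates nstates)
           (Write (Defs.Mem (Bin Add (Const base) (var 1))))))
     (Write (Const 0)).

(** * Correctness and running time *)

Section Program.

Variables (A : automaton) (w : nat).

Local Notation Q := (state A).
Local Notation n := #|state A|.
Local Notation k := #|letter A|.
Local Notation inp := (encode_automaton A).
Local Notation rank := enum_rank.

Hypothesis fits_cells : 8 + n * n < 2 ^ w.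
Hypothesis fits_input : 2 + n + k + n * k < 2 ^ w.

Let n_fits : n < 2 ^ w. Proof. lia. Qed.
Let k_fits : k < 2 ^ w. Proof. lia. Qed.
Let nn_fits : n * n < 2 ^ w. Proof. lia. Qed.
Let small_fits i : i < 9 -> i < 2 ^ w. Proof. lia. Qed.
Let bool_fits (b : bool) : b < 2 ^ w. Proof. by apply: small_fits; case: b. Qed.

Let rank_fits (x : Q) : rank x < 2 ^ w.
Proof. exact: ltn_trans (ltn_ord _) n_fits. Qed.

Let letter_fits (a : letter A) : rank a < 2 ^ w.
Proof. exact: ltn_trans (ltn_ord _) k_fits. Qed.

(** * Memory layout *)

(* Only the outermost variables [l] are known: a loop at nesting depth [size l]
   may clobber all the deeper ones. *)
Definition holds (l : seq nat) (R : rel Q) (m : seq nat) :=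
  exists u, size l + size u = base /\ m = l ++ u ++ encode_rel R.

Lemma holds_eq l R R' m : R =2 R' -> holds l R m -> holds l R' m.
Proof. by move/eq_encode_rel=> eqR [u [sz ->]]; exists u; rewrite eqR. Qed.

Lemma holds_onth l R m i j :
  onth l i = Some j -> holds l R m -> onth m i = Some j.
Proof.
move=> onth_l [u [_ ->]]; have lt_i := onth_size onth_l.
rewrite (onth_nth 0) ?size_cat ?ltn_addr // nth_cat lt_i.
by rewrite -(onth_nth 0).
Qed.

Lemma holds_matrix l R m i : i < n * n -> holds l R m ->
  onth m (base + i) = Some (nth 0 (encode_rel R) i).
Proof.
move=> lt_i [u [<- ->]].
rewrite (onth_nth 0) ?catA ?size_cat ?size_encode_rel ?ltn_add2l //.
by rewrite nth_cat size_cat ltnNge leq_addr /= addKn.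
Qed.

Lemma holds_entry l R m x y :
  holds l R m -> onth m (base + (rank x * n + rank y)) = Some (R x y : nat).
Proof.
move=> hm; rewrite (holds_matrix (rank_pair_lt x y) hm).
by rewrite /encode_rel nth_allpairs_enum.
Qed.

Lemma holds_upd l R m x y (b : bool) :
  holds l R m ->
  holds l (upd R x y b) (set_nth 0 m (base + (rank x * n + rank y)) b).
Proof.
case=> u [sz ->]; exists u; split=> //.
rewrite -set_nth_encode_rel -sz !catA.
have := size_cat l u; move: (l ++ u) => s <-.
by elim: s => //= x0 s ->.
Qed.

Lemma holds_size l R m : holds l R m -> base + n * n = size m.
Proof. by case=> u [<- ->]; rewrite !size_cat size_encode_rel addnA. Qed.

Lemma holds_rcons l i R m : holds (rcons l i) R m -> holds l R m.
Proof.
by case=> u [sz ->]; exists (i :: u); rewrite cat_rcons -sz size_rcons addnS.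
Qed.

(** Cell [size l] is the first of the unspecified cells [u], so writing it extends the known prefix
    and leaves the matrix intact. *)
Lemma holds_set_rcons l i R m :
  size l < base -> holds l R m -> holds (rcons l i) R (set_nth 0 m (size l) i).
Proof.
move=> lt_l [[|j u] [sz ->]]; first by rewrite addn0 in sz; lia.
exists u; rewrite -sz size_rcons addnS; split=> //; rewrite cat_rcons.
by elim: l {lt_l sz} => //= x l ->.
Qed.

(** * Evaluation of the expressions of the program *)

Lemma eval_nstates m : eval w inp m nstates = Some n.
Proof.
by apply: (@eval_inp _ _ _ _ 0) => //; apply: eval_const; apply: small_fits. Qed.

Lemma eval_nletters m : eval w inp m nletters = Some k.
Proof.
by apply: (@eval_inp _ _ _ _ 1) => //; apply: eval_const; apply: small_fits. Qed.

Lemma eval_ncells m : eval w inp m (Bin Mul nstates nstates) = Some (n * n).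
Proof. by apply: (eval_bin (eval_nstates m) (eval_nstates m)). Qed.

Lemma eval_cell m e1 e2 (x y : Q) :
    eval w inp m e1 = Some (rank x : nat) ->
    eval w inp m e2 = Some (rank y : nat) ->
  eval w inp m (cell e1 e2) = Some (base + (rank x * n + rank y)).
Proof.
move=> ev1 ev2; have lt_xy : rank x * n + rank y < n * n := rank_pair_lt x y.
apply: eval_add; first by apply: eval_const; apply: small_fits.
  apply: eval_add => //; last by lia.
  by apply: eval_mul ev1 (eval_nstates m) _ => //; lia.
by rewrite /base; lia.
Qed.

Lemma eval_target m e1 e2 (x : Q) (a : letter A) :
    eval w inp m e1 = Some (rank x : nat) ->
    eval w inp m e2 = Some (rank a : nat) ->
  eval w inp m (target e1 e2) = Some (rank (trans x a) : nat).
Proof.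
move=> ev1 ev2; have lt_xa : rank x * k + rank a < n * k := rank_pair_lt x a.
apply: (@eval_inp _ _ _ _ (2 + (rank x * k + rank a))) => //.
  apply: eval_add; first by apply: eval_const; apply: small_fits.
    apply: eval_add => //; last by lia.
    by apply: eval_mul ev1 (eval_nletters m) _ => //; lia.
  by lia.
rewrite /= (onth_nth 0) ?size_allpairs -?cardE //.
by rewrite nth_allpairs_enum.
Qed.

Section Eval.

Variables (l : seq nat) (R : rel Q) (m : seq nat).
Hypothesis holds_m : holds l R m.

Lemma eval_var i j :
  onth l i = Some j -> i < 9 -> j < 2 ^ w -> eval w inp m (var i) = Some j.
Proof.
move=> onth_i lt_i; apply: eval_mem (holds_onth onth_i holds_m).
exact/eval_const/small_fits.
Qed.

Lemma eval_entry e1 e2 (x y : Q) :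
    eval w inp m e1 = Some (rank x : nat) ->
    eval w inp m e2 = Some (rank y : nat) ->
  eval w inp m (entry e1 e2) = Some (R x y : nat).
Proof.
move=> ev1 ev2.
by apply: eval_mem (eval_cell ev1 ev2) (holds_entry _ _ holds_m) _.
Qed.

Lemma eval_and e1 e2 (b1 b2 : bool) :
    eval w inp m e1 = Some (b1 : nat) -> eval w inp m e2 = Some (b2 : nat) ->
  eval w inp m (Bin Mul e1 e2) = Some (b1 && b2 : nat).
Proof.
move=> ev1 ev2; rewrite -mulnb; apply: eval_mul => //=.
by rewrite mulnb.
Qed.

Lemma eval_or e1 e2 (b1 b2 : bool) : ~~ (b1 && b2) ->
    eval w inp m e1 = Some (b1 : nat) -> eval w inp m e2 = Some (b2 : nat) ->
  eval w inp m (Bin Add e1 e2) = Some (b1 || b2 : nat).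
Proof.
move=> nb12 ev1 ev2; have ->: (b1 || b2 : nat) = b1 + b2.
  by case: b1 b2 nb12 {ev1 ev2} => [] [].
apply: eval_add => //; apply: small_fits.
by case: b1 b2 {nb12 ev1 ev2} => [] [].
Qed.

Lemma eval_eq (T : finType) e1 e2 (x y : T) :
    eval w inp m e1 = Some (rank x : nat) ->
    eval w inp m e2 = Some (rank y : nat) ->
  eval w inp m (Bin Eq e1 e2) = Some (x == y : nat).
Proof.
move=> ev1 ev2; rewrite -(inj_eq (@enum_rank_inj T)) -val_eqE.
exact: (@eval_bin _ _ _ Eq _ _ _ _ ev1 ev2 (bool_fits _)).
Qed.

Lemma wp_set_entry e1 e2 e (x y : Q) (b : bool)
    (K : seq nat -> seq nat -> Prop) o :
    eval w inp m e1 = Some (rank x : nat) ->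
    eval w inp m e2 = Some (rank y : nat) ->
    eval w inp m e = Some (b : nat) ->
    (forall m', holds l (upd R x y b) m' -> K o m') ->
  wp w inp (Assign (cell e1 e2) e) (cost (cell e1 e2) + cost e).+1 K o m.
Proof.
move=> ev1 ev2 ev Km; apply: wp_assign (eval_cell ev1 ev2) ev _ _.
  by rewrite -(holds_size holds_m) ltn_add2l rank_pair_lt.
exact/Km/holds_upd.
Qed.

End Eval.

(** * Counted loops with matrix invariants *)

(** The ghost value [f] lets the known prefix change during the loop, as the success flag does. Body
    times have the form [a * B]; since [B] is positive, the overhead is absorbed into the
    coefficient, so nesting loops only adds to coefficients. The bound [N'] is any number above [N],
    such as [n.+1 * n.+1] above [n * n]. *)
Lemma wp_for_holds (X : Type) d (l : X -> seq nat) N N' e a B c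
    (S : nat -> seq nat -> X -> rel Q -> Prop) f R o m :
    (forall f, size (l f) = d) -> d < base ->
    (forall m, eval w inp m e = Some N) -> N < N' -> N < 2 ^ w -> 0 < B ->
    (forall i f R o m, i < N -> S i o f R -> holds (rcons (l f) i) R m ->
       wp w inp c (a * B) (fun o m => exists f R,
         S i.+1 o f R /\ holds (rcons (l f) i) R m) o m) ->
    S 0 o f R -> holds (l f) R m ->
  wp w inp (For d e c) ((a + cost e + 20) * (N' * B))
    (fun o m => exists f R, S N o f R /\ holds (l f) R m) o m.
Proof.
move=> sz_l lt_d evN ltN' ltN B_gt0 Sstep S0 hm.
pose J i o m := exists f R, S i o f R /\ holds (rcons (l f) i) R m.
have JE i f' : onth (rcons (l f') i) d = Some i.
  by rewrite (onth_nth 0) ?size_rcons ?sz_l // nth_rcons sz_l ltnn eqxx.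
apply: (@wp_conseq _ _ _ (N.+1 * (a * B + cost e + 20)) _ (J N)).
- apply: wp_for => //.
  + by apply: small_fits; rewrite /base in lt_d; lia.
  + by rewrite -(holds_size hm) ltn_addr.
  + by move=> i o' m' [f' [R' [_]]]; apply: holds_onth.
  + exists f, R; split=> //; rewrite -(sz_l f).
    by apply: holds_set_rcons; rewrite ?sz_l.
  + move=> i o' m' lt_i [f' [R' [Si hm']]].
    apply: wp_conseq (Sstep _ _ _ _ _ lt_i Si hm') (leqnn _) _.
    move=> o2 m2 {f' R' Si hm'} [f' [R' [Si hm']]]; split.
      exact: holds_onth hm'.
    exists f', R'; split=> //; rewrite -(sz_l f').
    by apply: holds_set_rcons (holds_rcons hm'); rewrite sz_l.
- by rewrite mulnCA leq_mul // !mulnDl !leq_add // leq_pmulr.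
- by move=> o' m' [f' [R' [SN /holds_rcons hm']]]; exists f', R'.
Qed.

Lemma wp_for_enum (T : finType) (X : Type) d (l : X -> seq nat) N' e a B c
    (S : nat -> seq nat -> X -> rel Q -> Prop) f R o m :
    (forall f, size (l f) = d) -> d < base ->
    (forall m, eval w inp m e = Some #|T|) -> #|T| < N' -> #|T| < 2 ^ w ->
    0 < B ->
    (forall x : T, forall f R o m, S (rank x) o f R ->
       holds (rcons (l f) (rank x)) R m ->
       wp w inp c (a * B) (fun o m => exists f R,
         S (rank x).+1 o f R /\ holds (rcons (l f) (rank x)) R m) o m) ->
    S 0 o f R -> holds (l f) R m ->
  wp w inp (For d e c) ((a + cost e + 20) * (N' * B))
    (fun o m => exists f R, S #|T| o f R /\ holds (l f) R m) o m.
Proof.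
move=> sz_l lt_d evT ltN' ltN B_gt0 Sstep; apply: wp_for_holds => //.
move=> i f' R' o' m' lt_i.
by have := Sstep (enum_val (Ordinal lt_i)) f' R' o' m'; rewrite enum_valK.
Qed.

(** * Initialising the matrix *)

Definition init_rel (p q : Q) : rel Q :=
  fun x y => (x == y) || ((x == p) && (y == q)).

(** The outer invariant says that the rows before [x] are filled, the inner one adds the entries of
    row [x] before [y]. Each loop bounded by [nstates] raises the coefficient by 22, the slack 20
    plus the cost 2 of the bound: 40, 62, 84. *)
Lemma wp_init_matrix f p q R o m :
    p != q -> holds [:: f; rank p : nat; rank q : nat] R m ->
  wp w inp init_matrix (84 * (n.+1 * (n.+1 * 1)))
    (fun o' m' => o' = o /\
       holds [:: f; rank p : nat; rank q : nat] (init_rel p q) m') o m.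
Proof.
move=> ne_pq hm; set l := [:: _; _; _] in hm *.
pose filled i R := forall x y : Q, rank x < i -> R x y = init_rel p q x y.
pose S i o' (_ : unit) R := o' = o /\ filled i R.
apply: (@wp_conseq _ _ _ _ _
  (fun o m => exists f R, S n o f R /\ holds l R m)) (leqnn _) _; last first.
  move=> o' m' [_ [R' [[-> fillR] hm']]]; split=> //.
  by apply: holds_eq hm' => x y; apply: fillR.
apply: (@wp_for_enum Q unit 3 (fun=> l) _ nstates 62 _ _ S tt R) => //.
- exact: eval_nstates.
move=> x [] {}R _ {hm}m [-> fillR] hm.
pose S' j o' (_ : unit) R :=
  [/\ o' = o, filled (rank x) R &
      forall y : Q, rank y < j -> R x y = init_rel p q x y].
apply: (@wp_conseq _ _ _ _ _
  (fun o m => exists f R, S' n o f R /\ holds (rcons l (rank x)) R m))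
  (leqnn _) _; last first.
  move=> o' m' [_ [R' [[-> fillR' rowR'] hm']]]; exists tt, R'; split=> //.
  split=> // x' y; rewrite enum_rank_ltS => /orP[/eqP->|]; last exact: fillR'.
  exact: rowR'.
apply: (@wp_for_enum Q unit 4 (fun=> rcons l (rank x)) _ nstates 40 1 _
  S' tt R) => //.
  exact: eval_nstates.
move=> y [] {hm}R _ {}m [-> {}fillR rowR] hm.
have ev1 : eval w inp m (var 1) = Some (rank p : nat) by apply: (eval_var hm).
have ev2 : eval w inp m (var 2) = Some (rank q : nat) by apply: (eval_var hm).
have ev3 : eval w inp m (var 3) = Some (rank x : nat) by apply: (eval_var hm).
have ev4 : eval w inp m (var 4) = Some (rank y : nat) by apply: (eval_var hm).
have ev :=
  eval_or _ (eval_eq ev3 ev4) (eval_and (eval_eq ev3 ev1) (eval_eq ev4 ev2)).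
apply: wp_leq (wp_set_entry hm ev3 ev4 (ev _) _) _ => //.
  (* If both bits were 1, then [x = y], [x = p] and [y = q], forcing [p = q]. *)
  by apply: contra ne_pq => /andP[/eqP-> /andP[/eqP <- /eqP <-]].
move=> m' hm'; exists tt, (upd R x y (init_rel p q x y)); split=> //.
split=> // [x' y' lt_x'|y']; rewrite /upd.
  by case: eqP lt_x' => [->|_ lt_x']; [rewrite ltnn | apply: fillR].
by rewrite eqxx enum_rank_ltS; case: eqP => [->|_ /rowR].
Qed.

(** * Monotone saturation of a matrix *)

(* [c] enlarges any matrix between [R0] and [U], staying below [U], to one
   satisfying [G].  Matrices are updated in place, so only the lower bound [R0],
   the matrix at the start of a round, is fixed. *)
Definition grows c t l (R0 U : rel Q) (G : rel Q -> Prop) :=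
  forall R o m, subrel R0 R -> subrel R U -> holds l R m ->
  wp w inp c t (fun o' m' => o' = o /\ exists R',
    [/\ holds l R' m', subrel R R', subrel R' U & G R']) o m.

Lemma grows_imply c t l (R0 U : rel Q) (G G' : rel Q -> Prop) :
    (forall R, subrel R0 R -> G R -> G' R) ->
  grows c t l R0 U G -> grows c t l R0 U G'.
Proof.
move=> GG' growsG R o m R0R RU hm.
apply: wp_conseq (growsG _ _ _ R0R RU hm) (leqnn t) _.
move=> _ m' [-> [R' [hm' RR' R'U GR']]]; split=> //; exists R'; split=> //.
by apply: GG' GR' => x y /R0R/RR'.
Qed.

(** The pass for [x] establishes [G x], and later passes keep it because the matrix only grows and
    [G x] is monotone. *)
Lemma grows_for_enum (T : finType) N' e a B c (l : seq nat) (R0 U : rel Q)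
    (G : T -> rel Q -> Prop) :
    size l < base -> (forall m, eval w inp m e = Some #|T|) -> #|T| < N' ->
    #|T| < 2 ^ w -> 0 < B ->
    (forall x R R', subrel R R' -> G x R -> G x R') ->
    (forall x, grows c (a * B) (rcons l (rank x : nat)) R0 U (G x)) ->
  grows (For (size l) e c) ((a + cost e + 20) * (N' * B)) l R0 U
    (fun R => forall x, G x R).
Proof.
move=> lt_l evT ltN' ltW B_gt0 monoG growsG R o m R0R RU hm.
pose S i o' (_ : unit) R' :=
  [/\ o' = o, subrel R R', subrel R' U & forall x, rank x < i -> G x R'].
apply: (@wp_conseq _ _ _ _ _
  (fun o m => exists f R, S #|T| o f R /\ holds l R m)) (leqnn _) _; last first.
  move=> o' m' [_ [R' [[-> RR' R'U GR'] hm']]]; split=> //; exists R'.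
  by split=> // x; apply: GR'.
apply: (@wp_for_enum T unit (size l) (fun=> l) N' e a B c S tt R) => //;
  last by split.
move=> x [] R1 _ m1 [-> RR1 R1U GR1] hm1.
have R0R1 : subrel R0 R1 by move=> y z /R0R/RR1.
apply: wp_conseq (growsG x R1 o m1 R0R1 R1U hm1) (leqnn _) _.
move=> _ m2 [-> [R2 [hm2 R12 R2U GR2]]]; exists tt, R2; split=> //.
split=> // [y z /RR1/R12 //|y]; rewrite enum_rank_ltS => /orP[/eqP-> //|].
by move/GR1; apply: monoG.
Qed.

(** Here the lower bound is renewed in every round: the matrix at the start of round [i] contains
    level [i], and the round adds level [i.+1]. *)
Lemma grows_for_levels N N' e a B c (l : seq nat) (R0 U : rel Q)
    (H : nat -> Q -> Q -> Prop) :
    size l < base -> (forall m, eval w inp m e = Some N) -> N < N' ->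
    N < 2 ^ w -> 0 < B -> (forall x y, H 0 x y -> R0 x y) ->
    (forall i (R1 : rel Q), (forall x y, H i x y -> R1 x y) ->
       grows c (a * B) (rcons l i) R1 U
         (fun R => forall x y, H i.+1 x y -> R x y)) ->
  grows (For (size l) e c) ((a + cost e + 20) * (N' * B)) l R0 U
    (fun R => forall x y, H N x y -> R x y).
Proof.
move=> lt_l evN ltN' ltW B_gt0 H0 growsH R o m R0R RU hm.
pose S i o' (_ : unit) (R' : rel Q) :=
  [/\ o' = o, subrel R R', subrel R' U & forall x y, H i x y -> R' x y].
apply: (@wp_conseq _ _ _ _ _
  (fun o m => exists f R, S N o f R /\ holds l R m)) (leqnn _) _; last first.
  by move=> o' m' [_ [R' [[-> RR' R'U HR'] hm']]]; split=> //; exists R'.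
apply: (@wp_for_holds unit (size l) (fun=> l) N N' e a B c S tt R) => //.
  move=> i [] R1 _ m1 _ [-> RR1 R1U HR1] hm1.
  apply: wp_conseq (growsH i R1 HR1 R1 o m1 _ R1U hm1) (leqnn _) _ => //.
  move=> _ m2 [-> [R2 [hm2 R12 R2U GR2]]]; exists tt, R2; split=> //.
  by split=> // y z /RR1/R12.
by split=> // x y /H0/R0R.
Qed.

(** The guard is read from the current matrix, which lies between [R0] and [U]. It therefore fires
    whenever it would for [R0], and when it fires it also holds of [U], so the new entry stays
    within [U]. *)
Lemma grows_set t l (R0 U : rel Q) e e1 e2 x y (b : rel Q -> bool) :
    (forall R m, holds l R m ->
      [/\ eval w inp m e = Some (b R : nat),
          eval w inp m e1 = Some (rank x : nat) &
          eval w inp m e2 = Some (rank y : nat)]) ->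
    (forall R R', subrel R R' -> b R -> b R') -> (b U -> U x y) ->
    (cost e).+1 + (cost (cell e1 e2) + 1).+1 <= t ->
  grows (If e (Assign (cell e1 e2) (Const 1)) Skip) t l R0 U
    (fun R => b R0 -> R x y).
Proof.
move=> ev mono_b bU le_t R o m R0R RU hm; have [ev_e ev1 ev2] := ev _ _ hm.
apply: wp_leq le_t; apply: (wp_if ev_e).
case bR: (b R) => /=; last first.
  apply: (@wp_leq _ _ _ 1) => //; apply: wp_skip; split=> //.
  exists R; split=> //.
  by move/(mono_b _ _ R0R); rewrite bR.
apply: (wp_set_entry (b := true) hm ev1 ev2); first exact/eval_const/small_fits.
move=> m' hm'; split=> //; exists (upd R x y true); split=> //.
- by move=> u v Ruv; rewrite /upd; case: ifP.
- move=> u v; rewrite /upd; case: ifP => [/andP[/eqP-> /eqP->] _|_ /RU //].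
  exact/bU/mono_b/bR.
- by rewrite /upd !eqxx.
Qed.

(** * Closure under the letters *)

Lemma grows_letter_round f p q r (R0 U : rel Q) :
    (forall x y a, U x y -> U (trans x a) (trans y a)) ->
  grows (For 4 nstates (For 5 nstates (For 6 nletters
      (If (entry (var 4) (var 5))
          (Assign (cell (target (var 4) (var 6)) (target (var 5) (var 6)))
                  (Const 1))
          Skip))))
    (126 * (n.+1 * (n.+1 * (k.+1 * 1)))) [:: f; p; q; r] R0 U
    (fun R => forall x y a, R0 x y -> R (trans x a) (trans y a)).
Proof.
move=> closedU.
apply: (@grows_for_enum Q n.+1 nstates 104 _ _ [:: f; p; q; r] _ _
  (fun x R => forall y a, R0 x y -> R (trans x a) (trans y a))) => //;
  first exact: eval_nstates.
  by move=> x R R' RR' GR y a /GR/RR'.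
move=> x; apply: (@grows_for_enum Q n.+1 nstates 82 _ _
  [:: f; p; q; r; rank x : nat] _ _
  (fun y R => forall a, R0 x y -> R (trans x a) (trans y a))) => //;
  first exact: eval_nstates.
  by move=> y R R' RR' GR a /GR/RR'.
move=> y; apply: (@grows_for_enum (letter A) k.+1 nletters 60 _ _
  [:: f; p; q; r; rank x : nat; rank y : nat] _ _
  (fun a R => R0 x y -> R (trans x a) (trans y a))) => //;
  first exact: eval_nletters.
  by move=> a R R' RR' GR /GR/RR'.
move=> a; apply: (@grows_set _ _ _ _ _ _ _ _ _ (fun R : rel Q => R x y)) => //.
- move=> R m hm.
  have ev4 : eval w inp m (var 4) = Some (rank x : nat) by apply: (eval_var hm).
  have ev5 : eval w inp m (var 5) = Some (rank y : nat) by apply: (eval_var hm).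
  have ev6 : eval w inp m (var 6) = Some (rank a : nat) by apply: (eval_var hm).
  by split; [apply: (eval_entry hm) | apply: eval_target | apply: eval_target].
- by move=> R R' RR' /RR'.
- exact: closedU.
Qed.

Lemma wp_close_letters f p q o m :
    holds [:: f; rank p : nat; rank q : nat] (init_rel p q) m ->
  wp w inp close_letters
    (151 * ((n.+1 * n.+1) * (n.+1 * (n.+1 * (k.+1 * 1)))))
    (fun o' m' => o' = o /\
       holds [:: f; rank p : nat; rank q : nat] (orbit_rel p q) m') o m.
Proof.
move=> hm; set l := [:: _; _; _] in hm *.
(* Level [i] is the diagonal together with the images of [(p, q)] under words of length at most
   [i]. *)
pose H i (x y : Q) := x = y \/ exists s,
  [/\ path (@pair_step A) (p, q) s, last (p, q) s = (x, y) & size s <= i].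
have closedU x y a := @orbit_rel_trans A p q x y a.
have initU : subrel (init_rel p q) (orbit_rel p q).
  move=> x y /orP[/eqP->|/andP[/eqP-> /eqP->]].
    by rewrite /orbit_rel eqxx.
  by rewrite /orbit_rel connect0 orbT.
have growsH : grows close_letters
    (151 * ((n.+1 * n.+1) * (n.+1 * (n.+1 * (k.+1 * 1))))) l (init_rel p q)
    (orbit_rel p q) (fun R => forall x y, H (n * n) x y -> R x y).
  apply: (@grows_for_levels (n * n) (n.+1 * n.+1) (Bin Mul nstates nstates) 126
    _ _ l) => //; first exact: eval_ncells.
  - exact: ltn_mul.
  - move=> x y [->|[s [_ + +]]]; first by rewrite /init_rel eqxx.
    case: s => // -[<- <-] _.
    by rewrite /init_rel !eqxx orbT.
  move=> i R1 HR1.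
  apply: grows_imply _ (grows_letter_round closedU).
  move=> R R1R GR x y [->|[s [+ + le_s]]].
    by apply/R1R/HR1; left.
  (* The last letter is split off: the shorter word is handled by the previous level, the letter by
     the current round. *)
  case/lastP: s le_s => [_ _ eq_xy|s v].
    by apply/R1R/HR1; right; exists [::].
  rewrite size_rcons rcons_path last_rcons => le_s /andP[s_path +] eq_v.
  rewrite {v}eq_v => /existsP[a /eqP[-> ->]]; apply/GR/HR1; right.
  by exists s; rewrite -surjective_pairing.
apply: wp_conseq (growsH (init_rel p q) o m _ initU hm) (leqnn _) _ => //.
move=> _ m' [-> [R [hm' _ RU HR]]]; split=> //.
apply: holds_eq hm' => x y; apply/idP/idP=> [/RU //|]; case/orP=> [/eqP->|].
  by apply: HR; left.
case/connectP=> s0 /shortenP[s s_path s_uniq _] eq_xy.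
apply: HR; right; exists s; split=> //.
(* The vertices of a repetition-free path are distinct pairs, so it has fewer than [n * n] steps. *)
have := max_card (mem ((p, q) :: s)).
by rewrite (card_uniqP s_uniq) card_prod; apply: ltnW.
Qed.

(** * Transitive closure *)

Lemma grows_trans_round f p q r (R0 U : rel Q) : transitive U ->
  grows (For 4 nstates (For 5 nstates (For 6 nstates
      (If (Bin Mul (entry (var 4) (var 5)) (entry (var 5) (var 6)))
          (Assign (cell (var 4) (var 6)) (Const 1))
          Skip))))
    (126 * (n.+1 * (n.+1 * (n.+1 * 1)))) [:: f; p; q; r] R0 U
    (fun R => forall x y z, R0 x y && R0 y z -> R x z).
Proof.
move=> transU.
apply: (@grows_for_enum Q n.+1 nstates 104 _ _ [:: f; p; q; r] _ _
  (fun x R => forall y z, R0 x y && R0 y z -> R x z)) => //.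
- exact: eval_nstates.
- by move=> x R R' RR' GR y z /GR/RR'.
move=> x; apply: (@grows_for_enum Q n.+1 nstates 82 _ _
  [:: f; p; q; r; rank x : nat] _ _
  (fun y R => forall z, R0 x y && R0 y z -> R x z)) => //.
- exact: eval_nstates.
- by move=> y R R' RR' GR z /GR/RR'.
move=> y; apply: (@grows_for_enum Q n.+1 nstates 60 _ _
  [:: f; p; q; r; rank x : nat; rank y : nat] _ _
  (fun z R => R0 x y && R0 y z -> R x z)) => //.
- exact: eval_nstates.
- by move=> z R R' RR' GR /GR/RR'.
move=> z.
apply: (@grows_set _ _ _ _ _ _ _ _ _ (fun R : rel Q => R x y && R y z)) => //.
- move=> R m hm.
  have ev4 : eval w inp m (var 4) = Some (rank x : nat) by apply: (eval_var hm).
  have ev5 : eval w inp m (var 5) = Some (rank y : nat) by apply: (eval_var hm).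
  have ev6 : eval w inp m (var 6) = Some (rank z : nat) by apply: (eval_var hm).
  by split=> //; apply: eval_and; apply: (eval_entry hm).
- by move=> R R' RR' /andP[/RR'-> /RR'->].
- by case/andP; apply: transU.
Qed.

Lemma wp_close_trans f p q (R0 : rel Q) o m :
    reflexive R0 -> holds [:: f; p; q] R0 m ->
  wp w inp close_trans (148 * (n.+1 * (n.+1 * (n.+1 * (n.+1 * 1)))))
    (fun o' m' => o' = o /\ holds [:: f; p; q] (connect R0) m') o m.
Proof.
move=> refl0 hm; set l := [:: f; p; q] in hm *.
(* Levels are shifted by one: the starting matrix already contains all paths of length at most 1,
   the empty ones by reflexivity. *)
pose H i (x y : Q) := exists s, [/\ path R0 x s, last x s = y & size s <= i.+1].
have sub0 : subrel R0 (connect R0) by apply: connect1.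
have growsH : grows close_trans (148 * (n.+1 * (n.+1 * (n.+1 * (n.+1 * 1))))) l
    R0 (connect R0) (fun R => forall x y, H n x y -> R x y).
  apply: (@grows_for_levels n n.+1 nstates 126 _ _ l) => //.
  - exact: eval_nstates.
  - move=> x y [s [+ + +]]; case: s => [_ <- _ //|z [|//]] /=.
    by rewrite andbT => ? <-.
  move=> i R1 HR1.
  apply: grows_imply _ (grows_trans_round (@connect_trans _ R0)).
  move=> R R1R GR x y [s [+ + le_s]].
  case/lastP: s le_s => [_ _ eq_xy|s z].
    by apply/R1R/HR1; exists [::].
  rewrite size_rcons rcons_path last_rcons => le_s /andP[s_path s_y] eq_z.
  (* The path is cut before its last edge; that edge is itself a path of length 1, so both halves
     belong to the previous level. *)
  rewrite {z}eq_z in s_y; apply: (GR _ (last x s)); apply/andP; split; apply: HR1.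
    by exists s.
  by exists [:: y]; rewrite /= s_y.
apply: wp_conseq (growsH R0 o m _ sub0 hm) (leqnn _) _ => //.
move=> _ m' [-> [R [hm' _ RU HR]]]; split=> //.
apply: holds_eq hm' => x y; apply/idP/idP=> [/RU //|].
case/connectP=> s0 /shortenP[s s_path s_uniq _] eq_y.
apply: HR; exists s; split=> //.
have := max_card (mem (x :: s)).
by rewrite (card_uniqP s_uniq) => /ltnW le_s; apply: leqW.
Qed.

(** * The antisymmetry test *)

Lemma wp_check_antisym f p q (R : rel Q) o m :
    holds [:: f; p; q] R m ->
  wp w inp check_antisym (3 + 104 * (n.+1 * (n.+1 * 1)))
    (fun o' m' => o' = o /\ exists2 F : bool,
       holds [:: F : nat; p; q] R m' & F <-> antisymmetric R) o m.
Proof.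
move=> hm; pose l (F : bool) := [:: F : nat; p; q].
have set_flag (F F' : bool) s m1 :
    holds [:: F : nat, p, q & s] R m1 ->
    holds [:: F' : nat, p, q & s] R (set_nth 0 m1 0 F').
  by case=> u [sz ->]; exists u.
pose S i o' (F : bool) R' := [/\ o' = o, R' = R &
  F <-> forall x y : Q, rank x < i -> R x y && R y x -> x = y].
apply: wp_seq; apply: (@wp_assign _ _ _ _ 0 1); try exact/eval_const/small_fits.
  by rewrite -(holds_size hm).
have {}hm : holds (l true) R (set_nth 0 m 0 1).
  by case: hm => u [sz ->]; exists u.
apply: (@wp_conseq _ _ _ _ _
  (fun o m => exists F R, S n o F R /\ holds (l F) R m)) (leqnn _) _; last first.
  move=> o' m' [F [_ [[-> -> FE] hm']]]; split=> //; exists F => //.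
  by rewrite FE; split=> anti x y; [apply: anti | move=> _; apply: anti].
apply: (@wp_for_enum Q bool 3 l n.+1 nstates 82 _ _ S true R) => //.
- exact: eval_nstates.
move=> x F _ _ {hm}m [-> -> FE] hm.
pose S' j o' (F' : bool) R' := [/\ o' = o, R' = R &
  F' <-> F /\ forall y : Q, rank y < j -> R x y && R y x -> x = y].
apply: (@wp_conseq _ _ _ _ _ (fun o m => exists F R,
  S' n o F R /\ holds (rcons (l F) (rank x)) R m)) (leqnn _) _; last first.
  move=> o' m' [F' [_ [[-> -> F'E] hm']]]; exists F', R; split=> //; split=> //.
  rewrite F'E FE; split=> [[anti antix] x' y | anti].
    by rewrite enum_rank_ltS => /orP[/eqP->|lt_x']; [apply: antix | apply: anti].
  by split=> [x' y lt_x'|y _]; apply: anti; rewrite // ltnS ltnW.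
apply: (@wp_for_enum Q bool 4 (fun F => rcons (l F) (rank x)) n.+1 nstates 60
  _ _ S' F R) => //.
- exact: eval_nstates.
- move=> y F' _ _ {hm}m [-> -> F'E] hm.
  have ev3 : eval w inp m (var 3) = Some (rank x : nat) by apply: (eval_var hm).
  have ev4 : eval w inp m (var 4) = Some (rank y : nat) by apply: (eval_var hm).
  have ev_ne : eval w inp m (Bin Eq (Bin Eq (var 3) (var 4)) (Const 0)) =
      Some (x != y : nat).
    rewrite (eval_bin (eval_eq ev3 ev4) (eval_const _ _ _) _) //=.
      by rewrite eqb0.
    exact: small_fits.
  have ev := eval_and
    (eval_and (eval_entry hm ev3 ev4) (eval_entry hm ev4 ev3)) ev_ne.
  (* One rule covers both branches: the new flag is the old one together with the absence of a
     violation at [(x, y)]. *)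
  have S'_step (F2 : bool) : F2 = F' && ~~ (R x y && R y x && (x != y)) ->
      S' (rank y).+1 o F2 R.
    move=> ->; split=> //; split.
      case/andP=> /F'E[-> antix] nxy; split=> // z.
      rewrite enum_rank_ltS => /orP[/eqP->|]; last exact: antix.
      by move=> Rxy; move: nxy; rewrite Rxy /= negbK => /eqP.
    case=> ? antix; apply/andP; split.
      by apply/F'E; split=> // z lt_z; apply: antix; rewrite ltnS ltnW.
    by apply/negP=> /andP[/antix -> //]; rewrite ?eqxx // ltnS.
  apply: (@wp_leq _ _ _ (32 + 3)) => //; apply: (wp_if ev).
  case bad: (R x y && R y x && (x != y)) => /=.
    apply: (@wp_assign _ _ _ _ 0 0); try exact/eval_const/small_fits.
      by rewrite -(holds_size hm).
    exists false, R; split; first by apply: S'_step; rewrite bad andbF.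
    exact: (set_flag _ false _ _ hm).
  apply: (@wp_leq _ _ _ 1) => //; apply: wp_skip; exists F', R.
  by split=> //; apply: S'_step; rewrite bad andbT.
- by split=> //; split=> // -[].
Qed.

(** * The search over candidate pairs *)

(** Vacuous on the diagonal, so skipped diagonal pairs satisfy it too. *)
Definition no_order (p q : Q) :=
  p != q -> ~ antisymmetric (principal_preorder p q).

Lemma wp_try_pair p q R o m :
    p != q -> holds [:: 0; rank p : nat; rank q : nat] R m ->
  wp w inp
    (Seq init_matrix (Seq close_letters (Seq close_trans check_antisym)))
    (490 * (k.+1 * n.+1 ^ 4))
    (fun o' m' => o' = o /\ exists (F : bool) R',
       holds [:: F : nat; rank p : nat; rank q : nat] R' m' /\
       if F then nontrivial_preserved_order R' else no_order p q) o m.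
Proof.
move=> ne_pq hm.
(* The coefficients 84, 151, 148, 3 and 104 of the phases add up to 490, and each is multiplied by
   at most [k.+1 * n.+1 ^ 4]. *)
apply: (@wp_leq _ _ _ (84 * (n.+1 * (n.+1 * 1)) +
  (151 * ((n.+1 * n.+1) * (n.+1 * (n.+1 * (k.+1 * 1)))) +
  (148 * (n.+1 * (n.+1 * (n.+1 * (n.+1 * 1)))) +
  (3 + 104 * (n.+1 * (n.+1 * 1))))))); last first.
  have sq_gt0 : 0 < n.+1 ^ 2 by rewrite expn_gt0.
  have -> : n.+1 ^ 4 = n.+1 ^ 2 * n.+1 ^ 2 by rewrite -expnD.
  rewrite !muln1 -!mulnn !mulnA in sq_gt0 *.
  by move: (n.+1 * n.+1) sq_gt0 => b; nia.
apply: wp_seq; apply: wp_conseq (wp_init_matrix _ ne_pq hm) (leqnn _) _.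
move=> _ m1 [-> hm1].
apply: wp_seq; apply: wp_conseq (wp_close_letters _ hm1) (leqnn _) _.
move=> _ m2 [-> hm2].
have refl_orbit : reflexive (orbit_rel p q) by move=> x; rewrite /orbit_rel eqxx.
apply: wp_seq; apply: wp_conseq (wp_close_trans _ refl_orbit hm2) (leqnn _) _.
move=> _ m3 [-> hm3].
apply: wp_conseq (wp_check_antisym _ hm3) (leqnn _) _.
move=> _ m4 [-> [F hm4 FE]]; split=> //; exists F, (principal_preorder p q).
split=> //; case: F FE {hm4} => [[/(_ isT) anti _]|[_ anti] _ /anti //].
exact: principal_order.
Qed.

(** The invariant depends on the flag: if it is set, the matrix is a nontrivial preserved order;
    otherwise every pair tried so far has failed. *)
Lemma wp_search R m :
    holds [:: 0] R m ->
  wp w inp search (544 * (n.+1 * (n.+1 * (k.+1 * n.+1 ^ 4))))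
    (fun o' m' => o' = [::] /\ exists (F : bool) R',
       holds [:: F : nat] R' m' /\
       if F then nontrivial_preserved_order R' else forall p q, no_order p q)
    [::] m.
Proof.
move=> hm; pose l (F : bool) := [:: F : nat].
have B_gt0 : 0 < k.+1 * n.+1 ^ 4 by rewrite muln_gt0 expn_gt0.
pose S i (o : seq nat) (F : bool) (R : rel Q) := o = [::] /\
  if F then nontrivial_preserved_order R
  else forall p q, rank p < i -> no_order p q.
apply: (@wp_conseq _ _ _ _ _
  (fun o m => exists F R, S n o F R /\ holds (l F) R m)) (leqnn _) _; last first.
  move=> o' m' [F [R' [[-> FE] hm']]]; split=> //; exists F, R'; split=> //.
  by case: F FE {hm'} => // no p q; apply: no.
apply: (@wp_for_enum Q bool 1 l n.+1 nstates 522 _ _ S false R) => //.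
- exact: eval_nstates.
move=> p F {hm}R _ {}m [-> FE] hm.
pose S' j (o : seq nat) (F' : bool) (R : rel Q) := o = [::] /\
  if F' then nontrivial_preserved_order R
  else (forall p' q, rank p' < rank p -> no_order p' q) /\
       (forall q, rank q < j -> no_order p q).
apply: (@wp_conseq _ _ _ _ _ (fun o m => exists F R,
  S' n o F R /\ holds (rcons (l F) (rank p)) R m)) (leqnn _) _; last first.
  move=> o' m' [F' [R' [[-> F'E] hm']]]; exists F', R'; split=> //; split=> //.
  case: F' F'E {hm'} => // -[no nop] p' q.
  by rewrite enum_rank_ltS => /orP[/eqP->|]; [apply: nop | apply: no].
apply: (@wp_for_enum Q bool 2 (fun F => rcons (l F) (rank p)) n.+1 nstates 500
  _ _ S' F R) => //; last by split=> //; case: F FE {hm}.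
- exact: eval_nstates.
move=> q F' {FE hm}R _ {}m [-> F'E] hm.
have ev0 : eval w inp m (var 0) = Some (F' : nat) by apply: (eval_var hm).
have ev1 : eval w inp m (var 1) = Some (rank p : nat) by apply: (eval_var hm).
have ev2 : eval w inp m (var 2) = Some (rank q : nat) by apply: (eval_var hm).
(* Both bits may be 1 here, so the value may be 2; the guard only asks whether it is nonzero. *)
have ev := eval_add ev0 (eval_eq ev1 ev2) _.
apply: (@wp_leq _ _ _ (9 + 490 * (k.+1 * n.+1 ^ 4))); last by nia.
apply: (wp_if (ev _)); first by apply: small_fits; case: (F') (p == q) => [] [].
case: ifP => [skip|].
  apply: (@wp_leq _ _ _ 1); last by nia.
  apply: wp_skip; exists F', R; split=> //; split=> //.
  case: F' F'E skip {ev ev0 hm} => // -[no nop] /=; rewrite eqb0 negbK => /eqP eq_pq.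
  by split=> // q'; rewrite enum_rank_ltS => /orP[/eqP->|/nop //] /eqP.
case: F' F'E {ev ev0} hm => // -[no nop] hm /=; rewrite eqb0 negbK => /negbT ne_pq.
apply: wp_conseq (wp_try_pair _ ne_pq hm) (leqnn _) _.
move=> _ m' [-> [F2 [R2 [hm2 F2E]]]]; exists F2, R2; split=> //; split=> //.
case: F2 F2E {hm2} => // nopq; split=> // q'.
by rewrite enum_rank_ltS => /orP[/eqP-> //|/nop].
Qed.

(** * Writing the answer *)

Lemma encode_rel_fits (R : rel Q) i : nth 0 (encode_rel R) i < 2 ^ w.
Proof.
have [lt_i|ge_i] := ltnP i (size (encode_rel R));
  last by rewrite nth_default // expn_gt0.
by have /allpairsP[[x y] [_ _ ->]] := mem_nth 0 lt_i; apply: bool_fits.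
Qed.

Lemma wp_report (F : bool) R m :
    holds [:: F : nat] R m ->
  wp w inp report (5 + 35 * (n.+1 * n.+1 * 1))
    (fun o' _ => o' = if F then 1 :: encode_rel R else [:: 0]) [::] m.
Proof.
move=> hm.
have ev0 : eval w inp m (var 0) = Some (F : nat) by apply: (eval_var hm).
apply: (@wp_leq _ _ _ (3 + (2 + 35 * (n.+1 * n.+1 * 1)))); last by lia.
apply: (wp_if ev0); case: F hm {ev0} => /= hm; last first.
  apply: (@wp_leq _ _ _ 2) => //.
  by apply: (@wp_write _ _ _ 0) => //; apply/eval_const/small_fits.
apply: wp_seq; apply: (@wp_write _ _ _ 1); first exact/eval_const/small_fits.
pose S i o (_ : unit) R' := R' = R /\ o = 1 :: take i (encode_rel R).
apply: (@wp_conseq _ _ _ _ _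
  (fun o m => exists f R, S (n * n) o f R /\ holds [:: 1] R m)) (leqnn _) _.
  apply: (@wp_for_holds unit 1 (fun=> [:: 1]) (n * n) _
    (Bin Mul nstates nstates) 10 1 _ S tt R) => //.
  - exact: eval_ncells.
  - exact: ltn_mul.
  - move=> i _ _ _ {hm}m lt_i [-> ->] hm.
    have ev1 : eval w inp m (var 1) = Some i.
      by apply: (eval_var hm) => //; apply: ltn_trans lt_i nn_fits.
    have ev : eval w inp m (Defs.Mem (Bin Add (Const base) (var 1))) =
        Some (nth 0 (encode_rel R) i).
      apply: eval_mem (holds_matrix lt_i hm) (encode_rel_fits _ _).
      by apply: eval_add => //; [apply/eval_const/small_fits | rewrite /base; lia].
    apply: (@wp_leq _ _ _ 6) => //; apply: (wp_write ev).
    exists tt, R; split=> //; split=> //=.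
    by rewrite (take_nth 0) ?size_encode_rel.
  - by split=> //; rewrite take0.
by move=> o' m' [_ [R' [[_ ->] _]]]; rewrite take_oversize // size_encode_rel.
Qed.

End Program.

(** * The whole program and the asymptotic bounds *)

Lemma halts_search_report (A : automaton) w :
    8 + #|state A| * #|state A| < 2 ^ w ->
    2 + #|state A| + #|letter A| + #|state A| * #|letter A| < 2 ^ w ->
  exists t out,
    [/\ halts w (base + #|state A| * #|state A|) (encode_automaton A)
          (Seq search report) t out,
        correct_output A out
      & t <= 600 * (#|letter A|.+1 * #|state A|.+1 ^ 6)].
Proof.
set n := #|state A|; set k := #|letter A| => fits1 fits2.
pose R0 : rel (state A) := fun _ _ => false.
have hm : holds [:: 0] R0 (nseq (base + n * n) 0).
  (* The zeroed memory reads as a cleared flag, six free cells and the matrix of the empty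
     relation. *)
  exists (nseq 6 0); split=> //; rewrite nseqD /=; do 7!congr (_ :: _).
  have/all_pred1P : all (pred1 0) (encode_rel R0).
    by apply/allP=> _ /allpairsP[? [_ _ ->]].
  by rewrite size_encode_rel.
have [t1 [o1 [m1 [ex1 le1 [+ [F [R1 [hm1 FE]]]]]]]] := wp_search fits1 fits2 hm.
move=> /= o1_nil; rewrite {}o1_nil in ex1.
have [t2 [o2 [m2 [ex2 le2 /= o2E]]]] := wp_report fits1 fits2 hm1.
exists (t1 + t2), ([::] ++ o2); split.
- by exists m2; apply: exec_seq ex1 ex2.
- rewrite /= o2E; case: F FE {hm1 o2E} => [ordR|no]; first by right; exists R1.
  left; split=> // -[r [r_order [p [q [ne_pq r_pq]]] r_pres]].
  apply: (no p q); first exact/eqP.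
  (* An order [r] with [r p q] would make the principal preorder of that pair antisymmetric,
     although the search rejected the pair. *)
  have sub_r := principal_preorder_min r_order r_pres r_pq.
  by case: r_order => _ anti_r _ x y /andP[/sub_r rxy /sub_r ryx];
    apply: anti_r; rewrite rxy.
have -> : n.+1 ^ 6 = n.+1 * (n.+1 * n.+1 ^ 4) by rewrite -!expnS.
have b_gt0 : 0 < n.+1 ^ 4 by rewrite expn_gt0.
apply: leq_trans (leq_add le1 le2) _; rewrite -/n -/k muln1.
move: (n.+1 ^ 4) b_gt0 => b b_gt0.
have -> : n.+1 * (n.+1 * (k.+1 * b)) = n.+1 * n.+1 * (k.+1 * b) by rewrite mulnA.
have -> : k.+1 * (n.+1 * (n.+1 * b)) = n.+1 * n.+1 * (k.+1 * b).
  by rewrite [LHS]mulnCA [X in _ * X = _]mulnCA !mulnA.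
have c_gt0 : 0 < k.+1 * b by rewrite muln_gt0.
have d_gt0 : 0 < n.+1 * n.+1 by [].
by move: (n.+1 * n.+1) (k.+1 * b) d_gt0 c_gt0 => d c; nia.
Qed.

(* Words have O(log (|Q| + |Sigma|)) bits and space is counted in words.  The
   program is correct on every automaton; the time bound is not claimed where
   |Sigma| * |Q| ^ 6 vanishes, nor the space bound where |Q| ^ 2 does. *)
Theorem proposition5 :
  exists (P : cmd) (C : nat), forall A : automaton,
  exists (w s t : nat) (out : seq nat),
    [/\ halts w s (encode_automaton A) P t out,
        correct_output A out,
        w <= C * up_log 2 (#|state A| + #|letter A|).+2,
        0 < #|state A| -> s <= C * #|state A| ^ 2
      & 0 < #|letter A| -> 0 < #|state A| ->
          t <= C * (#|letter A| * #|state A| ^ 6)].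
Proof.
(* The factor [2 ^ 7] replaces [k.+1] by [2 * k] and [n.+1 ^ 6] by [2 ^ 6 * n ^ 6] when [k] and [n]
   are positive. *)
exists (Seq search report), (600 * 2 ^ 7) => A.
set n := #|state A|; set k := #|letter A|; set b := (n + k).+2.
pose w := 8 * up_log 2 b.
(* Since [b] is at least 2, [2 ^ w >= b ^ 8 >= 2 ^ 6 * b ^ 2], which exceeds every address and input
   position. *)
have le_w : 64 * (b * b) <= 2 ^ w.
  have le_b : b <= 2 ^ up_log 2 b by apply: up_logP.
  have b_gt1 : 1 < b by [].
  rewrite /w (mulnC 8) expnM; move: (2 ^ up_log _ _) le_b => B le_b.
  apply: (@leq_trans (b ^ 8)); last by rewrite leq_exp2r.
  rewrite (expnD b 6 2 : b ^ 8 = _) mulnn leq_mul //.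
  by apply: (@leq_trans (2 ^ 6)); rewrite ?leq_exp2r.
have [||t [out [ex ok le_t]]] := @halts_search_report A w.
- by rewrite -/n; nia.
- by rewrite -/n -/k; nia.
have C_ge : 8 <= 600 * 2 ^ 7 by rewrite -[8]/(8 * 1) leq_mul // expn_gt0.
exists w, (base + n * n), t, out; split=> //.
- by rewrite leq_mul2r C_ge orbT.
- move=> n_gt0; apply: (@leq_trans (8 * n ^ 2));
    last by rewrite leq_mul2r C_ge orbT.
  by rewrite /base -mulnn; nia.
- move=> k_gt0 n_gt0; apply: leq_trans le_t _; rewrite -mulnA leq_mul2l.
  have le_k : k.+1 <= 2 * k by lia.
  have le_n : n.+1 ^ 6 <= 2 ^ 6 * n ^ 6 by rewrite -expnMn leq_exp2r //; lia.
  by rewrite expnS mulnACA leq_mul // orbT.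
Qed.
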